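(* For any $n\ge 0$, there exists a $1$-Gray code $\mathbb{Z}_n$ for $\mathcal{Z}_n$ whose first word is $0(001)^\star$ and whose last word is $(001)^\star$.
   Context: A binary word is $1$-decreasing if for every maximal run of $0$s, of length $a>0$, together with the (possibly empty) maximal run of $1$s immediately following it, of length $b$, one has $a>b$. For $n\ge1$, $\mathcal{Z}_n$ is the set of $1$-decreasing binary words of length $n$ that start with $0$; $\mathcal{Z}_0=\{\epsilon\}$ (the empty word). A $1$-Gray code for a set $\mathcal{A}$ of words of equal length is an ordered list of all elements of $\mathcal{A}$, each exactly once, such that any two consecutive words differ in at most one position (Hamming distance at most $1$). In a word of a prescribed length $n$ written as $u(001)^\star$, the symbol $(001)^\star$ denotes the prefix of $001001001\cdots$ of the length needed to make the whole word have length $n$ (e.g. for $n=7$, $(001)^\star=0010010$). *)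

(* Defs.v *)
From mathcomp Require Import all_boot.
Set Implicit Arguments. Unset Strict Implicit. Unset Printing Implicit Defensive.

(* Binary words are [seq bool], with [false] = 0 and [true] = 1. *)
Definition word := seq bool.

(* [w] is 1-decreasing: for every maximal run of 0s occupying positions
   [i, i+a) (a > 0), followed by the maximal (possibly empty) run of 1s
   occupying positions [i+a, i+a+b), one has a > b. *)
Definition one_decreasing (w : word) : Prop :=
  forall i a b : nat,
    0 < a ->
    i + a + b <= size w ->
    (forall k, i <= k < i + a -> nth false w k = false) ->
    (i = 0 \/ (0 < i /\ nth false w i.-1 = true)) ->
    (i + a = size w \/ nth false w (i + a) = true) ->
    (forall k, i + a <= k < i + a + b -> nth false w k = true) ->
    (i + a + b = size w \/ nth false w (i + a + b) = false) ->
    b < a.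

Definition inZ (n : nat) (w : word) : Prop :=
  size w = n /\ (n = 0 \/ head true w = false) /\ one_decreasing w.

Definition hamming (u v : word) : nat :=
  count (fun p => p.1 != p.2) (zip u v).

Definition gray1 (A : word -> Prop) (l : seq word) : Prop :=
  uniq l /\ (forall w, w \in l <-> A w) /\
  sorted (fun u v => hamming u v <= 1) l.

Definition pat001 (n : nat) : word := mkseq (fun i => i %% 3 == 2) n.

Definition first_word (n : nat) : word := take n (false :: pat001 n).

(* Main.v *)
Require Import Defs.
From mathcomp Require Import all_boot.
From mathcomp Require Import zify.

Set Implicit Arguments. Unset Strict Implicit. Unset Printing Implicit Defensive.

(* Write l_m = (001)^* and f_m = 0(001)^* for the extreme words of Z_m.  A word of
   Z_n other than 0^n is uniquely 0^(s-b) 1^b z with 0 < b <= (s-1)/2 and z in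
   Z_(n-s); by induction a Gray code of Z_(n-s) from l to f turns the words with
   a given s into a grid S_s whose columns are indexed by b.  Besides the edges
   of the grids, 0^(s-b) 1^b 0 z is adjacent to 0^(s-b) 1^(b+1) z, which links
   (S_s, b, f) to (S_(s+1), b+1, l), and 0^(s-1) 1 z is adjacent to 0^s z, which
   links (S_s, 1, l) to (S_(s+3), 1, l) and (S_s, 1, f) to (S_(s+4), 1, l).
   The Gray code visits S_4, S_5, S_8, S_9, S_12, ... on its way out, turns
   around at 0^n, visits the pairs S_(4q+2), S_(4q+3) on its way back, and ends
   with S_3.  The corners between which a grid has a Hamiltonian path depend on
   the parity of |Z_m|, which is even exactly when 3 divides m: this dictates the
   order inside each pair, and forces a different start when n = 1 mod 3. *)

(** * Words and Hamiltonian paths *)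

(** Distance exactly 1, so that every step changes the parity of the number of 1s. Since [zip]
    truncates, sizes are compared separately. *)
Definition adj (u v : word) := (size u == size v) && (hamming u v == 1).

Lemma hammingC u v : hamming u v = hamming v u.
Proof.
rewrite /hamming; elim: u v => [|x u IHu] [|y v] //=.
by rewrite IHu eq_sym.
Qed.

Lemma adjC u v : adj u v = adj v u.
Proof. by rewrite /adj hammingC eq_sym. Qed.

Lemma hamming_catl p u v : hamming (p ++ u) (p ++ v) = hamming u v.
Proof. by rewrite /hamming; elim: p => //= x p ->; rewrite eqxx. Qed.

Lemma adj_catl p u v : adj (p ++ u) (p ++ v) = adj u v.
Proof. by rewrite /adj hamming_catl !size_cat eqn_add2l. Qed.

Lemma adj_flip x u : adj (x :: u) (~~ x :: u).
Proof.
have huu : hamming u u = 0 by rewrite -[u]cats0 hamming_catl.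
by rewrite /adj /= eqxx -[hamming _ _]/(_ + hamming u u) huu; case: x.
Qed.

Lemma odd_hamming u v : size u = size v ->
  odd (hamming u v) = odd (count id u) (+) odd (count id v).
Proof.
rewrite /hamming; elim: u v => [|x u IHu] [|y v] //= [/IHu].
by rewrite !oddD => ->; case: x; case: y => /=; case: odd; case: odd.
Qed.

Definition blockw s b (z : word) : word := nseq (s - b) false ++ nseq b true ++ z.

Definition zerosw s (z : word) : word := nseq s false ++ z.

Lemma nseq_cons_cat T k (x : T) s : nseq k.+1 x ++ s = nseq k x ++ x :: s.
Proof. by rewrite -cat1s catA -[[:: x]]/(nseq 1 x) -nseqD addn1. Qed.

Lemma adj_row s b z : b < s -> adj (blockw s b z) (blockw s b.+1 z).
Proof.
move=> lt_bs; rewrite /blockw (_ : s - b = (s - b.+1).+1); last by lia.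
by rewrite nseq_cons_cat adj_catl; exact: (adj_flip false).
Qed.

Lemma adj_step s b z : adj (blockw s b (false :: z)) (blockw s.+1 b.+1 z).
Proof.
by rewrite /blockw subSS nseq_cons_cat !adj_catl; exact: (adj_flip false).
Qed.

Lemma adj_zeros s z : adj (blockw s.+1 1 z) (zerosw s.+1 z).
Proof.
rewrite /blockw /zerosw subSS subn0 (nseq_cons_cat s) adj_catl.
exact: (adj_flip true).
Qed.

Definition walk (x y : word) (l : seq word) :=
  if l is z :: p then [/\ z = x, last z p = y & path adj z p] else False.

Lemma walk_cat x y u v l1 l2 :
  walk x y l1 -> walk u v l2 -> adj y u -> walk x v (l1 ++ l2).
Proof.
case: l1 => //= a p [<- <- Hp]; case: l2 => //= b p' [<- <- Hp'] Ha.
by split; rewrite ?last_cat ?cat_path ?Hp //= Ha.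
Qed.

Lemma walk_rev x y l : walk x y l -> walk y x (rev l).
Proof.
case: l => //= a p [<- <- Hp].
have -> : rev (a :: p) = last a p :: rev (belast a p).
  by rewrite lastI rev_rcons.
split=> //; first by case: p {Hp} => //= b p; rewrite rev_cons last_rcons.
by rewrite rev_path; apply: sub_path Hp => u v; rewrite adjC.
Qed.

Definition hampath x y c := exists2 l, walk x y l & perm_eq l c.

Lemma hampath1 x : hampath x x [:: x].
Proof. by exists [:: x]. Qed.

Lemma hampath_perm c d x y : perm_eq c d -> hampath x y c -> hampath x y d.
Proof. by move=> Hp [l wl pl]; exists l => //; apply: perm_trans Hp. Qed.

Lemma hampath_rev x y c : hampath x y c -> hampath y x c.
Proof. by case=> l wl pl; exists (rev l); rewrite ?perm_rev //; apply: walk_rev. Qed.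

Lemma hampath_cat y u x v c d :
  hampath x y c -> adj y u -> hampath u v d -> hampath x v (c ++ d).
Proof.
move=> [l wl pl] Ha [l' wl' pl']; exists (l ++ l'); last exact: perm_cat.
exact: walk_cat Ha.
Qed.

Lemma hampath_map (f : word -> word) x y c :
  (forall u v, adj (f u) (f v) = adj u v) ->
  hampath x y c -> hampath (f x) (f y) (map f c).
Proof.
move=> Hf [[//|a p] /= [<- <- Hp] pl]; exists (map f (a :: p)); last exact: perm_map.
split; rewrite ?last_map // path_map; apply: sub_path Hp => u v.
by rewrite /= Hf.
Qed.

Lemma hampath_split x y c : x != y -> hampath x y c ->
  exists x' c', [/\ adj x x', hampath x' y c' & perm_eq c (x :: c')].
Proof.
move=> neq_xy [[//|a [|b p]] /= [ax def_y Hp] pl].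
  by rewrite -ax def_y eqxx in neq_xy.
case/andP: Hp; rewrite ax in pl * => Hab Hp.
by exists b, (b :: p); split; rewrite 1?perm_sym //; exists (b :: p).
Qed.

(** Parities of the number of 1s alternate along the path, so equal parities at the ends mean an odd
    number of vertices. *)
Lemma hampath_odd x y c : hampath x y c ->
  odd (size c) = ~~ (odd (count id x) (+) odd (count id y)).
Proof.
case=> [[//|a p] /= [<- <- Hp] /perm_size <-] {x y c} /=; congr (~~ _).
elim: p a Hp => [|b p IHp] a /=; first by rewrite addbb.
case/andP=> /andP[/eqP Hs /eqP Hh] /IHp ->.
have := odd_hamming Hs; rewrite Hh /=.
by case: odd; case: odd; case: odd.
Qed.

(** * Hamiltonian paths of grids *)

Definition col s b (c : seq word) := map (blockw s b) c.

Fixpoint cells s k (c : seq word) :=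
  if k is k'.+1 then col s k c ++ cells s k' c else [::].

Lemma perm_cells s k c d : perm_eq c d -> perm_eq (cells s k c) (cells s k d).
Proof. by move=> p_cd; elim: k => //= k IHk; rewrite perm_cat ?perm_map. Qed.

Lemma count_cells_cat a s k c d :
  count a (cells s k (c ++ d)) = count a (cells s k c) + count a (cells s k d).
Proof. by elim: k => //= k IHk; rewrite /col map_cat !count_cat IHk; lia. Qed.

Lemma hampath_col s b x y c :
  hampath x y c -> hampath (blockw s b x) (blockw s b y) (col s b c).
Proof. by apply: hampath_map => u v; rewrite /blockw !adj_catl. Qed.

(** Columns [k] down to 1 are traversed in alternating directions. *)
Lemma hampath_snake s k x y c : 0 < k < s -> hampath x y c ->
  hampath (blockw s k x) (blockw s 1 (if odd k then y else x)) (cells s k c).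
Proof.
case: k => // k /= lt_ks hc; elim: k x y hc lt_ks => [|k IHk] x y hc lt_ks /=.
  by rewrite cats0; apply: hampath_col.
have := IHk _ _ (hampath_rev hc) (ltnW lt_ks); rewrite /= !negbK if_neg => hk.
apply: hampath_cat hk; first exact: hampath_col hc.
by rewrite adjC adj_row // ltnW.
Qed.

(** Two neighbouring columns are visited row by row, changing column in each row; the parity of the
    number of rows decides the exit column. *)
Lemma hampath_zigzag s b x y c : b < s -> hampath x y c ->
  hampath (blockw s b.+1 x) (blockw s (if odd (size c) then b else b.+1) y)
    (col s b.+1 c ++ col s b c).
Proof.
move=> lt_bs [[//|a p] /= [ax py Hp] pl].
(* [t e] is the column in which a row is entered; the next row is entered in the other one, hence
   the induction for every [e]. *)
pose t (e : bool) := if e then b.+1 else b.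
have Hrow e z : adj (blockw s (t e) z) (blockw s (t (~~ e)) z).
  by case: e; rewrite /t /= ?adj_row // adjC adj_row.
suff h e : hampath (blockw s (t e) a) (blockw s (t (e (+) ~~ odd (size p))) (last a p))
    (col s b.+1 (a :: p) ++ col s b (a :: p)).
  rewrite -(perm_size pl) -ax -py /= if_neg; have := h true; rewrite /t addTb negbK.
  by apply: hampath_perm; rewrite perm_cat ?perm_map.
elim: p a e Hp {ax py pl} => [|u p IHp] a e.
  move=> _; rewrite /= addbT.
  apply: (hampath_perm (c := [:: blockw s (t e) a] ++ [:: blockw s (t (~~ e)) a])).
    by case: e => //=; apply/permP => z /=; lia.
  exact: hampath_cat (hampath1 _) (Hrow _ _) (hampath1 _).
move=> /andP[Hau /(IHp _ (~~ e)) hu].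
have := hu; rewrite addNb -addbN [size (u :: p)]/= [odd _.+1]/= {hu} => hu.
apply: (hampath_perm (c := [:: blockw s (t e) a] ++ ([:: blockw s (t (~~ e)) a]
  ++ (col s b.+1 (u :: p) ++ col s b (u :: p))))).
  by apply/permP => z; case: e {hu} => /=; rewrite !count_cat /=; lia.
apply: hampath_cat (hampath1 _) (Hrow _ _) _.
apply: hampath_cat (hampath1 _) _ hu.
by rewrite /blockw !adj_catl.
Qed.

(** With an odd number of rows, a zigzag through two columns leads from [x] to [y] as a single
    column does. The remaining snake then exits at the other end of column 1. *)
Lemma hampath_zigzag_snake s k x y c : 1 < k < s -> odd (size c) ->
  hampath x y c ->
  hampath (blockw s k x) (blockw s 1 (if odd k then x else y)) (cells s k c).
Proof.
case: k => [|[|[|k]]] // /= lt_ks odd_c hc.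
  have := hampath_zigzag (ltn_trans (ltnSn 1) lt_ks) hc.
  by rewrite odd_c cats0.
have lt_k2 : k.+2 < s by lia.
have := hampath_zigzag lt_k2 hc; rewrite odd_c catA => hz.
have lt_k1 : 0 < k.+1 < s by lia.
have := hampath_snake lt_k1 (hampath_rev hc); rewrite /= !negbK => hs.
by apply: hampath_cat hz _ hs; rewrite adjC adj_row // ltnW.
Qed.

(** The row of [x] is followed out to column [k]; the other rows are snaked back, reaching [y] since
    [k] is odd. *)
Lemma hampath_row_snake s k x y c : k < s -> odd k -> x != y ->
  hampath x y c -> hampath (blockw s 1 x) (blockw s 1 y) (cells s k c).
Proof.
move=> lt_ks odd_k neq_xy /(hampath_split neq_xy)[x' [c' [adj_x hc' pc]]].
have k_gt0 : 0 < k < s by case: k lt_ks odd_k.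
have := hampath_snake k_gt0 (hampath1 x); rewrite odd_k => /hampath_rev hx.
have := hampath_snake k_gt0 hc'; rewrite odd_k => hy.
apply: (hampath_perm (c := cells s k [:: x] ++ cells s k c')).
  rewrite perm_sym; apply: perm_trans (perm_cells s k pc) _.
  by apply/permP => a; rewrite -cat1s count_cells_cat count_cat.
by apply: hampath_cat hx _ hy; rewrite /blockw !adj_catl.
Qed.

(** * Enumeration of Z_n *)

Lemma pat001_add3 m : pat001 m.+3 = [:: false; false; true] ++ pat001 m.
Proof.
rewrite /pat001 /mkseq -[m.+3]/(3 + m) iotaD map_cat; congr (_ ++ _).
rewrite -[0 + 3]/(3 + 0) iotaDl -map_comp.
by apply: eq_map => i /=; rewrite -modnDml modnn.
Qed.

Lemma first_wordS m : first_word m.+1 = false :: pat001 m.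
Proof.
rewrite /first_word /= /pat001 /mkseq -map_take take_iota.
by rewrite (minn_idPl (leqnSn m)).
Qed.

Lemma odd_count_pat001 m : odd (count id (pat001 m)) = odd (m %/ 3).
Proof.
elim/ltn_ind: m => -[|[|[|m]]] // IHm.
have -> : m.+3 %/ 3 = (m %/ 3).+1 by lia.
by rewrite pat001_add3 count_cat oddD IHm //; lia.
Qed.

(** For m > 0 the ends contain floor(m/3) and floor((m-1)/3) ones, which agree unless 3 divides
    m. *)
Lemma odd_size_hampath m c : m %% 3 != 0 ->
  hampath (pat001 m) (first_word m) c -> odd (size c).
Proof.
case: m => // m m3 /hampath_odd->; rewrite first_wordS odd_count_pat001 /=.
by rewrite odd_count_pat001 (_ : m.+1 %/ 3 = m %/ 3) ?addbb //; lia.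
Qed.

Lemma pat001_neq_first_word m : 2 < m -> pat001 m != first_word m.
Proof. by case: m => [|[|[|m]]] // _; rewrite first_wordS. Qed.

(* The words of length [s + m] of the blocks S_t with t >= s, together with
   0^(s+m), when [G j] lists Z_j. *)
Fixpoint tail G s m :=
  cells s s.-1./2 (G m) ++
  (if m is m'.+1 then tail G s.+1 m' else [:: nseq s false]).

(* [f] is a fuel for the recursion on the length. *)
Fixpoint enumZ_rec f n :=
  if n isn't m.+3 then [:: nseq n false]
  else if f is f'.+1 then tail (enumZ_rec f') 3 m else [::].

Definition enumZ n := enumZ_rec n n.

Lemma eq_tail G G' s m : (forall j, j <= m -> G j = G' j) ->
  tail G s m = tail G' s m.
Proof.
elim: m s => [|m IHm] s eqG /=; rewrite eqG // IHm // => j le_jm.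
by rewrite eqG // ltnW.
Qed.

Lemma enumZ_rec_fuel f f' n : n <= f -> n <= f' ->
  enumZ_rec f n = enumZ_rec f' n.
Proof.
elim: f f' n => [|f IHf] [|f'] [|[|[|n]]] // le_nf le_nf'.
by apply: eq_tail => j le_jn; apply: IHf; lia.
Qed.

Lemma enumZ_add3 m : enumZ m.+3 = tail enumZ 3 m.
Proof. rewrite {1}/enumZ -[enumZ_rec _ _]/(tail (enumZ_rec m.+2) 3 m).
by apply: eq_tail => j le_jm; apply: enumZ_rec_fuel; lia.
Qed.

(** * First runs of a word, and membership in Z_n *)

Lemma run_decomposition (x : bool) w :
  exists k z, w = nseq k x ++ z /\ (z = [::] \/ head x z = ~~ x).
Proof.
elim: w => [|y w [k [z [-> Hz]]]]; first by exists 0, [::]; split; [|left].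
case: (eqVneq y x) => [->|neq_yx]; first by exists k.+1, z.
exists 0, (y :: nseq k x ++ z); split=> //; right.
by case: x y neq_yx {Hz} => -[].
Qed.

Lemma nth_runs a b (z : word) i :
  nth false (nseq a false ++ nseq b true ++ z) i =
  if i < a then false else if i < a + b then true else nth false z (i - (a + b)).
Proof.
rewrite !nth_cat !nth_nseq !size_nseq -!subnDA.
by case: ltnP => // ?; case: ltnP => ?; case: ltnP => //; lia.
Qed.

Lemma size_runs a b (z : word) :
  size (nseq a false ++ nseq b true ++ z) = a + b + size z.
Proof. by rewrite !size_cat !size_nseq addnA. Qed.

Lemma one_decreasing_zeros n : one_decreasing (nseq n false).
Proof.
move=> i a b a0; rewrite size_nseq => le_n _ _ _ ones _.
case: b le_n ones => // b le_n /(_ (i + a)); rewrite nth_nseq if_same => h.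
by have := h ltac:(lia).
Qed.

(** The runs of the whole word are 0^a, 1^b and the runs of [z] shifted by a + b; the condition on
    [head] makes 1^b maximal. *)
Lemma one_decreasing_runs a b z : 0 < b < a -> head false z = false ->
  one_decreasing (nseq a false ++ nseq b true ++ z) <-> one_decreasing z.
Proof.
move=> lt_ba z0; split=> dec i a' b' a'0; have hn := nth_runs a b z.
  move=> le_z zeros start stop ones fin.
  have shift k : nth false (nseq a false ++ nseq b true ++ z) (k + (a + b)) = nth false z k.
    by rewrite hn !ifF ?addnK //; lia.
  apply: (dec (i + (a + b))) => //.
  - by rewrite size_runs; lia.
  - move=> k hk; have := shift (k - (a + b)); rewrite subnK; last by lia.
    by move=> ->; apply: zeros; lia.
  (* Even a run at the very start of [z] is now preceded by a 1, the last letter of 1^b. *)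
  - right; split; first by lia.
    case: start => [->|[i0 zi]].
      by rewrite hn ifF ?ifT //; lia.
    by rewrite -[RHS]zi -shift; congr nth; lia.
  - case: stop => [sz|zi]; [left|right]; first by rewrite size_runs; lia.
    by rewrite -[RHS]zi -shift; congr nth; lia.
  - move=> k hk; have := shift (k - (a + b)); rewrite subnK; last by lia.
    by move=> ->; apply: ones; lia.
  - case: fin => [sz|zi]; [left|right]; first by rewrite size_runs; lia.
    by rewrite -[RHS]zi -shift; congr nth; lia.
rewrite size_runs => le_w zeros start stop ones fin.
have := zeros i; rewrite hn => zi.
(* Either [i] lies in 0^a and the runs are 0^a and 1^b, or it lies in [z]; it cannot lie in 1^b
   because letter [i] is 0. *)
have [lt_ia|le_ai] := ltnP i a.
  have i0 : i = 0.
    case: start => // -[i0]; rewrite hn ifT //; lia.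
  have le_a'a : a' <= a.
    rewrite leqNgt; apply/negP => lt_aa'; have := zeros a; rewrite hn ltnn ifT; lia.
  have ea : a' = a.
    case: stop => [|]; first by lia.
    by rewrite hn; case: ltnP => //; lia.
  rewrite ea; case/andP: lt_ba => b0 /(leq_ltn_trans _); apply.
  rewrite leqNgt; apply/negP => lt_bb'; have := ones (a + b).
  rewrite hn ltnn subnn nth0 z0 ifF; last by lia.
  by move=> h; have := h ltac:(lia).
have le_abi : a + b <= i.
  rewrite leqNgt; apply/negP => lt_i; move: zi; rewrite ifF ?ifT //; last by lia.
  by move=> h; have := h ltac:(lia).
have tr k : i <= k -> nth false (nseq a false ++ nseq b true ++ z) k = nth false z (k - (a + b)).
  by move=> le_ik; rewrite hn !ifF //; lia.
apply: (dec (i - (a + b))) => //.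
- by lia.
- move=> k hk; rewrite -[RHS](zeros (k + (a + b))) ?tr ?addnK //; lia.
- case: (posnP (i - (a + b))) => [|i0]; [by left | right; split=> //].
  case: start => [|[_]]; first by lia.
  rewrite hn !ifF; [|lia|lia] => <-; congr nth; lia.
- case: stop => [sz|zi']; [left; lia|right].
  by rewrite -[RHS]zi' tr; [congr nth|]; lia.
- move=> k hk; rewrite -[RHS](ones (k + (a + b))) ?tr ?addnK //; lia.
- case: fin => [sz|zi']; [left; lia|right].
  by rewrite -[RHS]zi' tr; [congr nth|]; lia.
Qed.

(** This is the recursion on which [enumZ] is modelled: deleting the first pair of runs leaves a
    word of the same kind. *)
Lemma inZ_cases n w : inZ n w <-> w = nseq n false \/
  exists a b z, [/\ 0 < b < a, a + b <= n, w = nseq a false ++ nseq b true ++ z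
    & inZ (n - (a + b)) z].
Proof.
split=> [[sz [hd dec]]|[->|[a [b [z [lt_ba le_n -> [sz [hd dec]]]]]]]]; last first.
- split; first by rewrite size_runs sz; lia.
  split; first by right; case: a lt_ba {le_n sz hd} => //; lia.
  apply/one_decreasing_runs => //.
  by case: z sz hd {dec} => //= x z sz [|//]; lia.
- split; first by rewrite size_nseq.
  by split; [case: n; [left|right] | apply: one_decreasing_zeros].
have [a [w1 [def_w hw1]]] := run_decomposition false w.
case: w1 def_w hw1 => [|x w1] def_w hw1.
  by left; rewrite def_w cats0 -sz def_w cats0 size_nseq.
case: hw1 => //= x1; right.
have [b [z [def_w1 hz]]] := run_decomposition true (x :: w1).
rewrite def_w1 in def_w; exists a, b, z.
have b0 : 0 < b.
  by case: b def_w1 {def_w} => //= def_w1; move: hz; rewrite -def_w1 x1 => -[].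
have hz0 : head false z = false by case: hz => [->|]; case: (z).
have a0 : 0 < a.
  case: a def_w => // def_w; case: hd => [n0|].
    by move: sz; rewrite def_w n0 size_runs; lia.
  by rewrite def_w; case: b b0 {def_w def_w1}.
have hn := nth_runs a b z; rewrite -def_w in hn.
have sw : size w = a + b + size z by rewrite def_w size_runs.
have lt_ba : b < a.
  apply: (dec 0 a b) => //; rewrite ?add0n ?sw.
  - by lia.
  - by move=> k hk; rewrite hn ifT //; lia.
  - by left.
  - by right; rewrite hn ifF ?ifT //; lia.
  - by move=> k hk; rewrite hn ifF ?ifT //; lia.
  - by right; rewrite hn !ifF ?subnn ?nth0 //; lia.
split=> //; first by rewrite b0.
  by lia.
split; first by lia.
split; first by case: hz => [z0|->]; [left; move: sz; rewrite sw z0 /=; lia | right].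
by move: dec; rewrite def_w => /one_decreasing_runs; apply; rewrite ?b0.
Qed.

Lemma mem_cells s k c w :
  reflect (exists b z, [/\ 0 < b <= k, z \in c & w = blockw s b z])
    (w \in cells s k c).
Proof.
apply: (iffP idP) => [|[b [z [le_bk z_c ->]]]].
  elim: k => //= k IHk; rewrite mem_cat.
  case/orP=> [/mapP[z z_c ->]|/IHk[b [z [le_bk z_c ->]]]].
    by exists k.+1, z; rewrite leqnn.
  by exists b, z; split=> //; lia.
elim: k le_bk => [|k IHk] /=; first by lia.
move=> le_bk; rewrite mem_cat; have [lt_kb|le_k] := ltnP k b.
  by rewrite (_ : b = k.+1) ?map_f //; lia.
by rewrite IHk ?orbT //; lia.
Qed.

Lemma mem_tail G s m w :
  reflect (w = nseq (s + m) false \/ exists t b z, [/\ s <= t <= s + m,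
      0 < b <= t.-1./2, z \in G (s + m - t) & w = blockw t b z])
    (w \in tail G s m).
Proof.
apply: (iffP idP); elim: m s => [|m IHm] s; rewrite /= mem_cat.
- case/orP=> [/mem_cells[b [z [le_b z_c ->]]]|]; last by rewrite inE addn0 => /eqP; left.
  by right; exists s, b, z; rewrite addn0 leqnn subnn.
- case/orP=> [/mem_cells[b [z [le_b z_c ->]]]|/IHm].
    by right; exists s, b, z; rewrite leqnn leq_addr addKn.
  rewrite addSnnS; case=> [|[t [b [z [le_t le_b z_c ->]]]]]; [by left|right].
  by exists t, b, z; split=> //; lia.
- rewrite addn0 => -[->|[t [b [z [le_t le_b z_c ->]]]]]; first by rewrite inE eqxx orbT.
  have est : t = s by lia.
  rewrite est subnn in le_b z_c *; apply/orP; left; apply/mem_cells.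
  by exists b, z.
case=> [ew|[t [b [z [le_t le_b z_c ew]]]]].
  by apply/orP; right; apply: IHm; left; rewrite addSnnS.
have [est|neq_st] := eqVneq s t.
  rewrite -est addKn in le_b z_c ew; apply/orP; left; apply/mem_cells.
  by exists b, z.
apply/orP; right; apply: IHm; right; exists t, b, z; rewrite addSnnS.
by split=> //; lia.
Qed.

Lemma mem_enumZ n w : w \in enumZ n <-> inZ n w.
Proof.
elim/ltn_ind: n w => n IHn w; rewrite inZ_cases.
case: n IHn => [|[|[|m]]] IHn.
1-3: rewrite inE; split=> [/eqP->|[->//|[a [b [z []]]]]]; by [left | lia].
rewrite enumZ_add3; split=> [/mem_tail|] h; [move: h|apply/mem_tail; move: h].
  case=> [->|[t [b [z [le_t le_b z_c ->]]]]]; [by left|right].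
  exists (t - b), b, z; split=> //; [lia|lia|].
  by apply/IHn; [lia|rewrite subnK //; lia].
case=> [->|[a [b [z [lt_ba le_n -> Hz]]]]]; [by left|right].
exists (a + b), b, z; rewrite /blockw addnK; split=> //; [lia|lia|].
by apply/IHn => //; lia.
Qed.

(** * Absence of repetitions in the enumeration *)

Lemma find_blockw s b z : 0 < b -> find id (blockw s b z) = s - b.
Proof.
case: b => // b _; rewrite find_cat has_nseq andbF size_nseq /=.
by rewrite addn0.
Qed.

Lemma blockw_inj s b : injective (blockw s b).
Proof. by move=> u v /eqP; rewrite !eqseq_cat // => /and3P[_ _ /eqP]. Qed.

Lemma uniq_cells s k c : k < s -> uniq c -> uniq (cells s k c).
Proof.
move=> lt_ks uniq_c; elim: k lt_ks => //= k IHk lt_ks.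
rewrite cat_uniq map_inj_uniq ?uniq_c ?IHk ?andbT //=; [|exact: ltnW|exact: blockw_inj].
apply/hasPn => _ /mem_cells[b [z [le_bk _ ->]]]; apply/mapP => -[z' _].
move/(congr1 (find id)); rewrite !find_blockw //; lia.
Qed.

Lemma uniq_tail G s m : 0 < s ->
  (forall j, uniq (G j)) -> (forall j z, z \in G j -> head false z = false) ->
  uniq (tail G s m).
Proof.
move=> s0 uG hG; have uC t j : 0 < t -> uniq (cells t t.-1./2 (G j)).
  by move=> t0; apply: uniq_cells => //; lia.
elim: m s s0 => [|m IHm] s s0 /=; rewrite cat_uniq uC //=.
  rewrite orbF andbT; apply/mem_cells => -[b [z [le_b _]]].
  move/(congr1 (find id)); rewrite find_blockw; last by lia.
  by have := hasNfind (a := id) (s := nseq s false); rewrite has_nseq andbF size_nseq => -> //; lia.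
rewrite IHm // andbT; apply/hasPn => w /mem_tail Hw.
apply/mem_cells => -[b [z [le_b z_G def_w]]]; case: Hw => [|[t [b' [z' [le_t le_b' _]]]]].
  rewrite def_w => /(congr1 (find id)); rewrite find_blockw; last by lia.
  have := hasNfind (a := id) (s := nseq (s.+1 + m) false).
  by rewrite has_nseq andbF size_nseq => -> //; lia.
rewrite def_w => ew; have := congr1 (find id) ew; rewrite !find_blockw; [|lia|lia].
(* With equally many leading 0s in blocks s < t, letter [s] is the first one of [z], hence 0, in the
   shorter block, and still a 1 in the longer. *)
move=> e; have := congr1 (fun w => nth false w s) ew.
rewrite /blockw !nth_runs.
do 3![case: ltnP => ?; first by lia]; case: ltnP => ?; last by lia.
by rewrite (_ : s - _ = 0) ?nth0 ?(hG _ _ z_G) //; lia.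
Qed.

Lemma uniq_enumZ n : uniq (enumZ n).
Proof.
elim/ltn_ind: n => -[|[|[|m]]] // IHn; rewrite enumZ_add3.
(* [uniq_tail] constrains all [G j], while the induction covers only short lengths; [tail] reads
   only those with j <= m. *)
pose G j := if j <= m then enumZ j else [::].
have -> : tail enumZ 3 m = tail G 3 m.
  by apply: eq_tail => j le_jm; rewrite /G le_jm.
apply: uniq_tail => // j; rewrite /G; case: leqP => // le_jm.
  by apply: IHn; lia.
by case=> // x z /mem_enumZ[sz [[j0|//] _]]; rewrite j0 in sz.
Qed.

(** * Visiting the blocks *)

(** With [adj_zeros], this is the link from (S_s, 1, l) to (S_(s+3), 1, l). *)
Lemma zerosw_pat001 s m : zerosw s (pat001 m.+3) = blockw s.+3 1 (pat001 m).
Proof.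
rewrite pat001_add3 /zerosw /blockw subSS subn0 -addn2 nseqD -catA.
by [].
Qed.

(** Followed by [zerosw_pat001], this gives the link from (S_s, 1, f) to (S_(s+4), 1, l). *)
Lemma zerosw_first_word s m :
  zerosw s (first_word m.+1) = zerosw s.+1 (pat001 m).
Proof. by rewrite first_wordS /zerosw nseq_cons_cat. Qed.

Lemma zerosw_nseq s m : zerosw s (nseq m false) = nseq (s + m) false.
Proof. by rewrite nseqD. Qed.

Lemma adj_step_first_word s b m :
  adj (blockw s b (first_word m.+1)) (blockw s.+1 b.+1 (pat001 m)).
Proof. by rewrite first_wordS adj_step. Qed.

Definition solved m := hampath (pat001 m) (first_word m) (enumZ m).

(** S_s is snaked from (1, f) to (k, f), which is linked to (k+1, l) in S_(s+1); a zigzag there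
    exits at (1, l) because |Z_m| is odd. *)
Lemma hampath_pairA s k m : ~~ odd k -> 1 < k < s -> solved m -> solved m.+1 ->
  m %% 3 != 0 ->
  hampath (blockw s 1 (first_word m.+1)) (blockw s.+1 1 (pat001 m))
    (cells s k (enumZ m.+1) ++ cells s.+1 k.+1 (enumZ m)).
Proof.
move=> even_k lt_ks hm hm1 m3; have lt_k : 0 < k < s by lia.
have := hampath_snake lt_k (hampath_rev hm1).
rewrite (negPf even_k) => /hampath_rev h.
have lt_k1 : 1 < k.+1 < s.+1 by lia.
have := hampath_zigzag_snake lt_k1 (odd_size_hampath m3 hm) hm.
by rewrite /= even_k; apply: hampath_cat h (adj_step_first_word _ _ _).
Qed.

(** The blocks come in the opposite order: S_(s+1) is snaked and S_s zigzagged, so |Z_(m+1)| has to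
    be odd. *)
Lemma hampath_pairB s k m : ~~ odd k -> 1 < k < s -> solved m -> solved m.+1 ->
  m.+1 %% 3 != 0 ->
  hampath (blockw s.+1 1 (first_word m)) (blockw s 1 (pat001 m.+1))
    (cells s k (enumZ m.+1) ++ cells s.+1 k.+1 (enumZ m)).
Proof.
move=> even_k lt_ks hm hm1 m3; have lt_k1 : 0 < k.+1 < s.+1 by lia.
have := hampath_snake lt_k1 hm; rewrite /= even_k => /hampath_rev h.
have := hampath_zigzag_snake lt_ks (odd_size_hampath m3 hm1) (hampath_rev hm1).
rewrite (negPf even_k) => h'.
apply: hampath_perm (hampath_cat h _ h'); first by rewrite perm_catC.
by rewrite adjC adj_step_first_word.
Qed.

(** Zigzags in both blocks move the entry into S_(s+1) from (1, f) to (1, l). *)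
Lemma hampath_pairC s k m : ~~ odd k -> 1 < k < s -> solved m -> solved m.+1 ->
  m %% 3 != 0 -> m.+1 %% 3 != 0 ->
  hampath (blockw s.+1 1 (pat001 m)) (blockw s 1 (pat001 m.+1))
    (cells s k (enumZ m.+1) ++ cells s.+1 k.+1 (enumZ m)).
Proof.
move=> even_k lt_ks hm hm1 m3 m3'; have lt_k1 : 1 < k.+1 < s.+1 by lia.
have := hampath_zigzag_snake lt_k1 (odd_size_hampath m3 hm) hm.
rewrite /= even_k => /hampath_rev h.
have := hampath_zigzag_snake lt_ks (odd_size_hampath m3' hm1) (hampath_rev hm1).
rewrite (negPf even_k) => h'.
apply: hampath_perm (hampath_cat h _ h'); first by rewrite perm_catC.
by rewrite adjC adj_step_first_word.
Qed.

(** Both blocks are snaked: [k] odd and k + 1 even put both ends at (1, l), whatever the number of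
    rows. *)
Lemma hampath_front s k m : odd k -> k < s -> solved m -> solved m.+1 ->
  hampath (blockw s 1 (pat001 m.+1)) (blockw s.+1 1 (pat001 m))
    (cells s k (enumZ m.+1) ++ cells s.+1 k.+1 (enumZ m)).
Proof.
move=> odd_k lt_ks hm hm1; have k0 : 0 < k by case: k odd_k {lt_ks}.
have lt_k : 0 < k < s by rewrite k0.
have := hampath_snake lt_k (hampath_rev hm1); rewrite odd_k => /hampath_rev h.
have lt_k1 : 0 < k.+1 < s.+1 by [].
have := hampath_snake lt_k1 hm; rewrite /= odd_k /=.
exact: hampath_cat h (adj_step_first_word _ _ _).
Qed.

(** * Recursion over four consecutive blocks *)

Lemma tail_cons G s m :
  tail G s m.+1 = cells s s.-1./2 (G m.+1) ++ tail G s.+1 m.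
Proof. by []. Qed.

Lemma half_runs q : [/\ (q * 4).+4.-1./2 = (q * 2).+1,
  (q * 4).+4.+1.-1./2 = (q * 2).+2, (q * 4).+4.+2.-1./2 = (q * 2).+2
  & (q * 4).+4.+3.-1./2 = (q * 2).+3].
Proof. by split; lia. Qed.

Lemma tail_add4 G q m : tail G (q * 4).+4 m.+4 =
  (cells (q * 4).+4 (q * 2).+1 (G m.+4) ++
   cells (q * 4).+4.+1 (q * 2).+2 (G m.+3)) ++
  (cells (q * 4).+4.+2 (q * 2).+2 (G m.+2) ++
   cells (q * 4).+4.+3 (q * 2).+3 (G m.+1)) ++ tail G (q.+1 * 4).+4 m.
Proof.
rewrite !tail_cons; have [-> -> -> ->] := half_runs q.
by rewrite -!catA.
Qed.

(* Both start at the corner (1, l) of S_(4q+4), in words of length 4q + 4 + m.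
   The last word of a path of type A is adjacent to the corner (1, f) of
   S_(4q+3); that of a path of type B is adjacent to both (S_(4q+2), 1, f) and
   (S_(4q+3), 1, l). *)
Definition hampathA q m := hampath (blockw (q * 4).+4 1 (pat001 m))
  (zerosw (q * 4).+4 (pat001 m)) (tail enumZ (q * 4).+4 m).

Definition hampathB q m := hampath (blockw (q * 4).+4 1 (pat001 m))
  (zerosw (q * 4).+3 (pat001 m.+1)) (tail enumZ (q * 4).+4 m).

Lemma perm_cat_mid (T : eqType) (c d e : seq T) : perm_eq ((c ++ e) ++ d) (c ++ d ++ e).
Proof. by rewrite -catA perm_cat2l perm_catC. Qed.

(** Past S_(4q+4) and S_(4q+5), a link leads to S_(4q+8). The inner path ends next to (S_(4q+6), 1,
    f), where pair A starts; it ends at (S_(4q+7), 1, l), which is 0^(4q+4) l_(m+4). *)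
Lemma hampathA_step q m : (forall j, j <= m.+4 -> solved j) -> m.+4 %% 3 != 0 ->
  hampathB q.+1 m -> hampathA q m.+4.
Proof.
move=> IH m3 h; rewrite /hampathA tail_add4.
have lt_k : (q * 2).+1 < (q * 4).+4 by lia.
have ho : odd (q * 2).+1 by lia.
have := hampath_front ho lt_k (IH m.+3 _) (IH m.+4 _) => /(_ ltac:(lia) ltac:(lia)) h1.
have he : ~~ odd (q * 2).+2 by lia.
have lt_k2 : 1 < (q * 2).+2 < (q * 4).+4.+2 by lia.
have := hampath_pairA he lt_k2 (IH m.+1 _) (IH m.+2 _).
move=> /(_ ltac:(lia) ltac:(lia) ltac:(lia)) h2.
rewrite -zerosw_pat001 in h2.
apply: hampath_perm (perm_cat_mid _ _ _) _.
apply: hampath_cat (hampath_cat h1 _ h) _ h2.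
  by rewrite -(zerosw_pat001 (q * 4).+4.+1); exact: adj_zeros.
by rewrite adjC -zerosw_first_word; exact: adj_zeros.
Qed.

(** The inner path ends at 0^(4q+7) f_(m+1), next to (S_(4q+7), 1, f). Pair B then leads to
    (S_(4q+6), 1, l), which is 0^(4q+3) l_(m+5). *)
Lemma hampathB_stepB q m : (forall j, j <= m.+4 -> solved j) -> m.+2 %% 3 != 0 ->
  hampathA q.+1 m -> hampathB q m.+4.
Proof.
move=> IH m3 h; rewrite /hampathB tail_add4.
have ho : odd (q * 2).+1 by lia.
have lt_k : (q * 2).+1 < (q * 4).+4 by lia.
have he : ~~ odd (q * 2).+2 by lia.
have lt_k2 : 1 < (q * 2).+2 < (q * 4).+4.+2 by lia.
have h1 := hampath_front ho lt_k (IH m.+3 ltac:(lia)) (IH m.+4 ltac:(lia)).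
have h2 := hampath_pairB he lt_k2 (IH m.+1 ltac:(lia)) (IH m.+2 ltac:(lia)) m3.
rewrite -(zerosw_pat001 _ m.+2) in h2.
apply: hampath_perm (perm_cat_mid _ _ _) _.
apply: hampath_cat (hampath_cat h1 _ h) _ h2.
  by rewrite -(zerosw_pat001 (q * 4).+4.+1); exact: adj_zeros.
by rewrite adjC -zerosw_first_word; exact: adj_zeros.
Qed.

(** The inner path ends at 0^(4q+7) l_(m+1), next to (S_(4q+7), 1, l), where pair C starts. *)
Lemma hampathB_stepC q m : (forall j, j <= m.+4 -> solved j) ->
  m.+1 %% 3 != 0 -> m.+2 %% 3 != 0 -> hampathB q.+1 m -> hampathB q m.+4.
Proof.
move=> IH m3 m3' h; rewrite /hampathB tail_add4.
have ho : odd (q * 2).+1 by lia.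
have lt_k : (q * 2).+1 < (q * 4).+4 by lia.
have he : ~~ odd (q * 2).+2 by lia.
have lt_k2 : 1 < (q * 2).+2 < (q * 4).+4.+2 by lia.
have h1 := hampath_front ho lt_k (IH m.+3 ltac:(lia)) (IH m.+4 ltac:(lia)).
have h2 := hampath_pairC he lt_k2 (IH m.+1 ltac:(lia)) (IH m.+2 ltac:(lia)) m3 m3'.
rewrite -(zerosw_pat001 _ m.+2) in h2.
apply: hampath_perm (perm_cat_mid _ _ _) _.
apply: hampath_cat (hampath_cat h1 _ h) _ h2.
  by rewrite -(zerosw_pat001 (q * 4).+4.+1); exact: adj_zeros.
by rewrite adjC; exact: adj_zeros.
Qed.

Lemma tail0 G s : tail G s 0 = cells s s.-1./2 (G 0) ++ [:: nseq s false].
Proof. by []. Qed.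

Lemma solved_small m : m < 3 -> solved m.
Proof. by case: m => [|[|[|m]]] // _; exact: hampath1. Qed.

Lemma hampathB1 q : hampathB q 1.
Proof.
rewrite /hampathB !tail_cons tail0; have [-> -> _ _] := half_runs q.
have ho : odd (q * 2).+1 by lia.
have lt_k : (q * 2).+1 < (q * 4).+4 by lia.
have h1 := hampath_front ho lt_k (solved_small (isT : 0 < 3)) (solved_small (isT : 1 < 3)).
rewrite catA -[X in zerosw _ X]/(nseq 2 false) zerosw_nseq addn2.
apply: hampath_cat h1 _ (hampath1 _).
by rewrite -[X in adj _ X]cats0; exact: adj_zeros.
Qed.

Lemma hampathB3 q : (forall j, j <= 3 -> solved j) -> hampathB q 3.
Proof.
move=> IH; rewrite /hampathB !tail_cons tail0; have [-> -> -> ->] := half_runs q.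
have ho : odd (q * 2).+1 by lia.
have lt_k : (q * 2).+1 < (q * 4).+4 by lia.
have he : ~~ odd (q * 2).+2 by lia.
have lt_k2 : 1 < (q * 2).+2 < (q * 4).+4.+2 by lia.
have h1 := hampath_front ho lt_k (IH 2 isT) (IH 3 isT).
have h2 := hampath_pairB he lt_k2 (IH 0 isT) (IH 1 isT) isT.
rewrite (zerosw_pat001 _ 1) catA [cells (_.+4.+2) _ _ ++ _]catA.
apply: hampath_perm (perm_cat_mid _ _ _) _.
apply: hampath_cat (hampath_cat h1 _ (hampath1 _)) _ h2.
  have -> : nseq (q * 4).+4.+3 false = zerosw (q * 4).+4.+1 (pat001 2).
    by rewrite (zerosw_nseq _ 2) addn2.
  exact: adj_zeros.
by rewrite adjC -[X in adj _ X]cats0; exact: adj_zeros.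
Qed.

(** * Interleaving blocks whose grids are single rows *)

Lemma cells0 s c : cells s 0 c = [::].
Proof. by []. Qed.

Lemma cellsS s k c : cells s k.+1 c = col s k.+1 c ++ cells s k c.
Proof. by []. Qed.

#[local] Opaque cells.

(** Rearrangements of lists become linear identities between sums of an arbitrary weight, within
    reach of [lia]. *)
Lemma perm_sumnP (c d : seq word) :
  (forall f : word -> nat, sumn (map f c) = sumn (map f d)) <-> perm_eq c d.
Proof.
split=> [h|p_cd f]; last exact/perm_sumn/perm_map.
by apply/permP => a; rewrite -!sumn_count h.
Qed.

Lemma hampath_square s c z : c.+2 < s ->
  hampath (blockw s c.+2 (false :: z)) (blockw s.+1 c.+1 z)
    [:: blockw s c.+2 (false :: z); blockw s c.+1 (false :: z);
        blockw s.+1 c.+2 z; blockw s.+1 c.+1 z].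
Proof.
move=> lt_cs; exists [:: blockw s c.+2 (false :: z); blockw s c.+1 (false :: z);
  blockw s.+1 c.+2 z; blockw s.+1 c.+1 z] => //.
split=> //=; rewrite adj_step (adjC (blockw s c.+2 _)) (adjC (blockw s.+1 c.+2 _)).
by rewrite !adj_row //; lia.
Qed.

(** Squares on two consecutive columns of both rows are chained by [adj_step] edges; columns 1 to
    [b] remain unvisited. *)
Lemma hampath_ladder s b k z : 0 < k -> k * 2 + b < s ->
  exists2 c, hampath (blockw s (k * 2 + b) (false :: z)) (blockw s.+1 b.+1 z) c &
    perm_eq (c ++ cells s b [:: false :: z] ++ cells s.+1 b [:: z])
      (cells s (k * 2 + b) [:: false :: z] ++ cells s.+1 (k * 2 + b) [:: z]).
Proof.
case: k => // k _; elim: k => [|k IHk] lt_ks.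
  eexists; first exact: hampath_square.
  by apply/perm_sumnP => f; rewrite !cellsS ?cells0 !map_cat !sumn_cat /=; lia.
rewrite -[k.+2 * 2 + b]/(k.+1 * 2 + b).+2 in lt_ks *.
have [c hc pc] := IHk (ltn_trans (ltnW (ltnSn _)) lt_ks).
move: (k.+1 * 2 + b) lt_ks hc pc => d lt_ks hc pc.
eexists.
  apply: hampath_cat (hampath_square _ lt_ks) _ hc.
  by rewrite adjC; exact: adj_step.
apply/perm_sumnP => f; move/perm_sumnP/(_ f): pc.
by rewrite !cellsS ?cells0 !map_cat !sumn_cat /=; lia.
Qed.

Lemma adj_zeros_nseq s t :
  adj (blockw s.+1 1 (nseq t false)) (nseq (s.+1 + t) false).
Proof. by rewrite nseqD; exact: adj_zeros. Qed.

Lemma hampath_triple x y z : adj x y -> adj y z -> hampath x z [:: x; y; z].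
Proof. by move=> xy yz; exists [:: x; y; z]; rewrite //= xy yz. Qed.

(* For m = 4 and m = 6 the recursion would need the false cases m = 0 and m = 2:
   the last three blocks, whose grids are single rows, have to be interleaved. *)
Lemma hampathB4 q : 0 < q -> (forall j, j <= 4 -> solved j) -> hampathB q 4.
Proof.
move=> q0 IH; rewrite /hampathB tail_add4 tail0.
have [-> _ _ _] := half_runs q.+1.
have ho : odd (q * 2).+1 by lia.
have lt_k : (q * 2).+1 < (q * 4).+4 by lia.
have h1 := hampath_front ho lt_k (IH 3 isT) (IH 4 isT).
rewrite (zerosw_pat001 _ 2) -[(q.+1 * 4).+4]/(q * 4).+4.+4 -[(q.+1 * 2).+1]/(q * 2).+3.
have lt_q : q * 2 < (q * 4).+4 by lia.
move: (q * 4).+4 h1 lt_q {lt_k} => s h1 lt_q.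
have lt_g : 0 < (q * 2).+3 < s.+4 by lia.
have /hampath_rev hg := hampath_snake lt_g (hampath1 [::]).
rewrite if_same in hg.
(* With s = 4q + 4, [a] and [e] are the single rows of S_(s+2) and S_(s+3). *)
pose a b := blockw s.+2 b [:: false; false].
pose e b := blockw s.+3 b [:: false].
have he : hampath (e (q * 2).+2) (a (q * 2).+2) [:: e (q * 2).+2; e (q * 2).+3; a (q * 2).+2].
  by apply: hampath_triple; [apply: adj_row; lia | rewrite adjC; exact: adj_step].
have lt_l : q * 2 + 1 < s.+2 by lia.
have [c hl pc] := hampath_ladder [:: false] q0 lt_l; rewrite addn1 in hl pc.
have hz : hampath (e 1) (a 1) [:: e 1; nseq s.+4 false; a 1].
  apply: hampath_triple; last rewrite adjC.
    by rewrite -[s.+4]addn1; exact: (adj_zeros_nseq _ 1).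
  by rewrite -[s.+4]addn2; exact: (adj_zeros_nseq _ 2).
(* The row of S_(s+4) is followed outwards; rows [a] and [e] are then visited together inwards, and
   0^n joins their first cells. *)
apply: hampath_perm (hampath_cat h1 _ (hampath_cat hg _ (hampath_cat he _
  (hampath_cat hl _ hz)))).
- apply/perm_sumnP => f; move/perm_sumnP/(_ f): pc.
  rewrite -[enumZ 2]/[:: [:: false; false]] -[enumZ 1]/[:: [:: false]] -[enumZ 0]/[:: [::]].
  by rewrite /a /e !cellsS ?cells0 !map_cat !sumn_cat /=; lia.
- by rewrite -(zerosw_pat001 s.+1 0); exact: adj_zeros.
- by rewrite adjC; exact: adj_step.
- by rewrite adjC adj_row //; lia.
by rewrite adjC adj_row.
Qed.

Lemma hampathB6 q : (forall j, j <= 6 -> solved j) -> hampathB q 6.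
Proof.
move=> IH; rewrite /hampathB tail_add4 !tail_cons tail0.
have [-> -> -> _] := half_runs q.+1.
have ho : odd (q * 2).+1 by lia.
have lt_k4 : 0 < (q * 2).+1 < (q * 4).+4 by lia.
have := hampath_snake lt_k4 (hampath_rev (IH 6 isT)); rewrite ho => /hampath_rev h4.
have he : ~~ odd (q * 2).+2 by lia.
have lt_k5 : 1 < (q * 2).+2 < (q * 4).+4.+1 by lia.
(* A zigzag makes S_(4q+5) end at (1, f): 0^(4q+5) f_5 is the first cell of the row [e] of
   S_(4q+9). *)
have := hampath_zigzag_snake lt_k5 (odd_size_hampath (isT : 5 %% 3 != 0) (IH 5 isT)) (IH 5 isT).
rewrite (negPf he) => h5.
have lt_k6 : 1 < (q * 2).+2 < (q * 4).+4.+2 by lia.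
have h2 := hampath_pairB he lt_k6 (IH 3 isT) (IH 4 isT) isT.
rewrite (zerosw_pat001 _ 4) -[(q.+1 * 4).+4]/(q * 4).+4.+4 -[q.+1 * 2]/(q * 2).+2.
have lt_q : q * 2 < (q * 4).+4 by lia.
move: (q * 4).+4 h4 h5 h2 lt_q {lt_k4 lt_k5 lt_k6 ho he} => s h4 h5 h2 lt_q.
pose a b := blockw s.+4 b [:: false; false].
pose e b := blockw s.+4.+1 b [:: false].
have lt_g : 0 < (q * 2).+4 < s.+4.+2 by lia.
have hg := hampath_snake lt_g (hampath1 [::]).
rewrite if_same in hg.
have he : hampath (a (q * 2).+3) (e (q * 2).+3) [:: a (q * 2).+3; e (q * 2).+4; e (q * 2).+3].
  by apply: hampath_triple; [exact: adj_step | rewrite adjC; apply: adj_row; lia].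
have lt_l : q.+1 * 2 + 0 < s.+4 by lia.
have [c /hampath_rev hl pc] := hampath_ladder [:: false] (ltn0Sn q) lt_l.
rewrite addn0 -[q.+1 * 2]/(q * 2).+2 in hl pc.
pose o : word := nseq s.+4.+2 false.
(* Rows [a] and [e] are now visited outwards, the row of S_(s+6) inwards; 0^n then leads to the last
   pair, since f_3 = 000. *)
apply: hampath_perm (hampath_cat h4 (adj_step_first_word _ _ _) (hampath_cat h5 _ 
  (hampath_cat hl _ (hampath_cat he _ (hampath_cat hg _ (hampath_cat (hampath1 o) _ h2)))))).
- apply/perm_sumnP => f; move/perm_sumnP/(_ f): pc.
  rewrite -[enumZ 2]/[:: [:: false; false]] -[enumZ 1]/[:: [:: false]] -[enumZ 0]/[:: [::]].
  by rewrite /a /e /o !cellsS ?cells0 !map_cat !sumn_cat /=; lia.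
- by rewrite -(zerosw_pat001 s.+2 1) -zerosw_first_word; exact: adj_zeros.
- by rewrite adj_row //; lia.
- exact: adj_step.
- by rewrite -[o]cats0; exact: adj_zeros.
rewrite adjC /o -[s.+4.+2]/(3 + s.+3) addnC; exact: (adj_zeros_nseq _ 3).
Qed.

(** Adding 4 shifts the residue mod 3 by one: for m = 0, 1, 2 mod 3, the step to m + 4 turns B into
    B, B into A, and A into B. Neither type is available at m = 0 or 2, so 4 and 6 are base
    cases. *)
Lemma hampathAB m : (forall j, j <= m -> solved j) -> forall q,
  (m %% 3 = 2 -> 4 < m -> hampathA q m) /\
  (m %% 3 != 2 -> 0 < m -> 0 < q -> hampathB q m).
Proof.
elim/ltn_ind: m => m IHm IH q.
have [->|m1] := eqVneq m 1; first by split=> // _ _ _; exact: hampathB1.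
have [m3|m3] := eqVneq m 3.
  by rewrite m3 in IH *; split=> // _ _ _; exact: hampathB3.
have [m4|m4] := eqVneq m 4.
  by rewrite m4 in IH *; split=> // _ _ q0; exact: hampathB4.
have [m6|m6] := eqVneq m 6.
  by rewrite m6 in IH *; split=> // _ _ _; exact: hampathB6.
case: m IHm IH m1 m3 m4 m6 => [|[|[|[|m]]]] // IHm IH _ _ m4 m6.
have [hA hB] := IHm m ltac:(lia) (fun j le_jm => IH j ltac:(lia)) q.+1.
split=> [m2 _|m2 _ q0]; first by apply: hampathA_step; [|lia|apply: hB; lia].
have [m1|m1] := eqVneq (m.+4 %% 3) 1.
  by apply: hampathB_stepC => //; [lia|lia|apply: hB; lia].
by apply: hampathB_stepB => //; [lia|apply: hA; lia].
Qed.

(** The order is S_4, S_5, S_6, S_9, S_8, all blocks from S_12 on, S_10, S_11, S_7. Zigzags occur in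
    S_5, S_8 and S_11, whose numbers of rows are odd. *)
Lemma hampathA0_step3 m : (forall j, j <= m.+4.+4 -> solved j) ->
  m %% 3 = 1 -> hampathB 2 m -> hampathA 0 m.+4.+4.
Proof.
move=> IH m3 h12; rewrite /hampathA 8!tail_cons -[(0 * 4).+4]/4.
have m1 : m.+1 %% 3 != 0 by lia.
have m4 : m.+4 %% 3 != 0 by lia.
have m7 : m.+4.+3 %% 3 != 0 by lia.
have h4 := hampath_snake (isT : 0 < 1 < 4) (IH m.+4.+4 ltac:(lia)).
have h5 := hampath_zigzag_snake (isT : 1 < 2 < 5)
  (odd_size_hampath m7 (IH m.+4.+3 ltac:(lia))) (IH m.+4.+3 ltac:(lia)).
have h6 := hampath_snake (isT : 0 < 2 < 6) (IH m.+4.+2 ltac:(lia)).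
have h7 := hampath_row_snake (isT : 3 < 7) isT
  (pat001_neq_first_word (isT : 2 < m.+4.+1)) (IH m.+4.+1 ltac:(lia)).
have h8 := hampath_zigzag_snake (isT : 1 < 3 < 8)
  (odd_size_hampath m4 (IH m.+4 ltac:(lia))) (hampath_rev (IH m.+4 ltac:(lia))).
have h9 := hampath_snake (isT : 0 < 4 < 9) (IH m.+3 ltac:(lia)).
have h10 := hampath_snake (isT : 0 < 4 < 10) (hampath_rev (IH m.+2 ltac:(lia))).
have h11 := hampath_zigzag_snake (isT : 1 < 5 < 11)
  (odd_size_hampath m1 (IH m.+1 ltac:(lia))) (IH m.+1 ltac:(lia)).
rewrite /hampathB -[(2 * 4).+4]/12 -[(2 * 4).+3]/11 in h12.
rewrite (zerosw_pat001 4).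
apply: hampath_perm (hampath_cat h4 (adj_step_first_word _ _ _)
  (hampath_cat h5 (adj_step_first_word _ _ _) (hampath_cat h6 _
  (hampath_cat (hampath_rev h9) _ (hampath_cat h8 _ (hampath_cat h12 _
  (hampath_cat (hampath_rev h10) (adj_step_first_word _ _ _)
  (hampath_cat h11 _ (hampath_rev h7))))))))).
- by apply/perm_sumnP => f; rewrite !map_cat !sumn_cat /=; lia.
- by rewrite -(zerosw_pat001 6); exact: adj_zeros.
- by rewrite adjC adj_step_first_word.
- by rewrite -(zerosw_pat001 9) -zerosw_first_word; exact: adj_zeros.
- by rewrite adjC -zerosw_first_word; exact: adj_zeros.
by rewrite adjC -(zerosw_pat001 8) -zerosw_first_word; exact: adj_zeros.
Qed.

(** The type A path starts at 0001 l_m = f_(m+4) and ends at 000 f_(m+1), next to 001 f_(m+1); the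
    single column of S_3 then leads to l_(m+4). *)
Lemma solved_hampathA0 m : solved m.+1 -> hampathA 0 m -> solved m.+4.
Proof.
move=> hm h; apply: hampath_rev.
rewrite first_wordS !pat001_add3 enumZ_add3 tail_cons.
have h3 := hampath_rev (hampath_snake (isT : 0 < 1 < 3) hm).
apply: hampath_perm (hampath_cat h _ h3); first by rewrite perm_catC.
by rewrite adjC -zerosw_first_word; exact: adj_zeros.
Qed.

(** * Short words and conclusion *)

Definition flip (w : word) i : word := set_nth false w i (~~ nth false w i).

(** The list [p] of positions to flip in turn is a certificate checked by computation. *)
Lemma solved_flips n p :
  [&& last (pat001 n) (scanl flip (pat001 n) p) == first_word n,
    path adj (pat001 n) (scanl flip (pat001 n) p)
    & perm_eq (pat001 n :: scanl flip (pat001 n) p) (enumZ n)] ->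
  solved n.
Proof.
case/and3P=> /eqP hl hp pl.
by exists (pat001 n :: scanl flip (pat001 n) p).
Qed.

#[local] Transparent cells.

(** These are the lengths n >= 3 out of reach of the recursion, which needs n - 4 to be at least 5,
    9 or 7 according as it is 2, 0 or 1 mod 3. *)
Lemma solved_base n : n \in [:: 3; 4; 5; 6; 7; 8; 10] -> solved n.
Proof.
rewrite !inE; do ![case/predU1P=> [->|]] => [||||||/eqP->].
- by apply: (@solved_flips _ [:: 2]); vm_compute.
- by apply: (@solved_flips _ [:: 2; 3]); vm_compute.
- by apply: (@solved_flips _ [:: 2; 4; 3; 4]); vm_compute.
- by apply: (@solved_flips _ [:: 5; 2; 5; 4; 5; 3; 4]); vm_compute.
- apply: (@solved_flips _ [:: 5; 6; 2; 5; 4; 6; 4; 5; 4; 3; 4; 6]).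
  by vm_compute.
- apply: (@solved_flips _ [:: 2; 4; 6; 4; 7; 5; 2; 6; 7; 6; 2; 6; 4; 3; 7; 3;
    4; 3; 7; 6]).
  by vm_compute.
apply: (@solved_flips _ [:: 2; 4; 5; 3; 9; 3; 8; 3; 9; 7; 3; 7; 5; 6; 9; 6; 4;
  2; 9; 2; 6; 9; 5; 2; 6; 2; 3; 8; 3; 2; 7; 2; 6; 9; 5; 8; 5; 2; 7; 2; 6; 2; 7;
  2; 3; 8; 3; 2; 7; 2; 3; 8; 6; 9]).
by vm_compute.
Qed.

Lemma solved_all n : solved n.
Proof.
elim/ltn_ind: n => n IHn.
have [/solved_small //|n3] := ltnP n 3.
have [/solved_base //|] := boolP (n \in [:: 3; 4; 5; 6; 7; 8; 10]).
case: n n3 IHn => [|[|[|[|m]]]] // _ IHn; rewrite !inE => nb.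
apply: solved_hampathA0; first by apply: IHn; lia.
have IH j : j <= m -> solved j by move=> le_jm; apply: IHn; lia.
have [m2|m2] := eqVneq (m %% 3) 2.
  by have [h _] := hampathAB IH 0; apply: h; lia.
(* Here n = 1 mod 3, the case with the different start. *)
have [m0|m0] := eqVneq (m %% 3) 0.
  have [m' em] : exists m', m = m'.+4.+4 by exists (m - 8); lia.
  rewrite {nb}em in IH IHn m0 m2 *; apply: hampathA0_step3 => //; first by lia.
  have IH' j : j <= m' -> solved j by move=> le_jm; apply: IH; lia.
  by have [_ h] := hampathAB IH' 2; apply: h; lia.
have [m' [em m'0]] : exists m', m = m'.+4 /\ 0 < m' by exists (m - 4); lia.
rewrite {nb}em in IH IHn m0 m2 *; apply: hampathA_step => //.
have IH' j : j <= m' -> solved j by move=> le_jm; apply: IH; lia.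
by have [_ h] := hampathAB IH' 1; apply: h; lia.
Qed.

Theorem theorem3 (n : nat) :
  exists l : seq word,
    gray1 (inZ n) l /\
    head [::] l = first_word n /\
    last [::] l = pat001 n.
Proof.
have [[//|w l] [hw hl hp] pl] := hampath_rev (solved_all n).
exists (w :: l); split=> //; split; first by rewrite (perm_uniq pl) uniq_enumZ.
split=> [v|]; first by rewrite (perm_mem pl) mem_enumZ.
by apply: sub_path hp => u v /andP[_ /eqP->].
Qed.
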